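(* For every even integer $k \ge 0$, there exists a graph $G$ such that $\mathrm{lcr}^\circ(G) = k$ and $\mathrm{sn}(G) = k+2$.
   Context: A convex drawing of a finite simple graph $G$ places the vertices at distinct points of a circle and draws every edge as a straight-line segment; it is outer $k$-planar if every edge crosses at most $k$ other edges. The convex local crossing number $\mathrm{lcr}^\circ(G)$ is the smallest $k$ such that $G$ admits an outer $k$-planar drawing. A pair $(A,B)$ of vertex sets of a graph $H$ with $n$ vertices is a separation if $A\cup B=V(H)$ and there is no edge between $A\setminus B$ and $B\setminus A$; it is balanced if $|A\setminus B|\le 2n/3$ and $|B\setminus A|\le 2n/3$; its order is $|A\cap B|$. The separation number $\mathrm{sn}(G)$ is the minimum integer $s$ such that every subgraph of $G$ has a balanced separation of order at most $s$. *)

(* Defs.v *)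
From mathcomp Require Import all_boot all_order all_algebra.
From mathcomp Require Import boolp reals.

Set Implicit Arguments.
Unset Strict Implicit.
Unset Printing Implicit Defensive.

Import Order.TTheory GRing.Theory Num.Theory.

(* A graph has its own vertex set inside an ambient finite type of labels, so
   that a graph and its subgraphs are objects of the same type. *)
Record sgraph (T : finType) := SGraph {
  vertices : {set T};
  edges : {set {set T}};
  edgesP : forall e, e \in edges -> e \subset vertices /\ #|e| = 2
}.

Definition subgraph (T : finType) (H G : sgraph T) : Prop :=
  vertices H \subset vertices G /\ edges H \subset edges G.

Definition is_least (P : nat -> Prop) (n : nat) : Prop :=
  P n /\ forall m, P m -> n <= m.

Section Drawings.
Local Open Scope ring_scope.
Variables (R : realType) (T : finType).

(* The values of the drawing [p] outside the vertex set are irrelevant. *)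
Definition convex_drawing (G : sgraph T) (p : T -> R * R) : Prop :=
  {in vertices G &, injective p} /\
  exists (c : R * R) (r : R), 0 < r /\
    {in vertices G, forall v,
       ((p v).1 - c.1) ^+ 2 + ((p v).2 - c.2) ^+ 2 = r ^+ 2}.

Definition in_open_segment (p : T -> R * R) (e : {set T}) (q : R * R) : Prop :=
  exists (x y : T) (t : R),
    [/\ e = [set x; y], 0 < t < 1 &
        q = ((1 - t) * (p x).1 + t * (p y).1,
             (1 - t) * (p x).2 + t * (p y).2)].

(* [e <> f] is needed because an edge meets itself; edges sharing an endpoint
   never cross, since no three points of a circle are collinear. *)
Definition crosses (p : T -> R * R) (e f : {set T}) : Prop :=
  e <> f /\ exists q, in_open_segment p e q /\ in_open_segment p f q.

Definition outer_planar_drawing (G : sgraph T) (p : T -> R * R) (k : nat) :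
    Prop :=
  convex_drawing G p /\
  {in edges G, forall e,
     (#|[set f in edges G | `[< crosses p e f >]]| <= k)%N}.

Definition outer_planar (G : sgraph T) (k : nat) : Prop :=
  exists p : T -> R * R, outer_planar_drawing G p k.

End Drawings.

Definition is_convex_lcr (R : realType) (T : finType) (G : sgraph T)
    (k : nat) : Prop :=
  is_least (outer_planar R G) k.

Definition separation (T : finType) (H : sgraph T) (A B : {set T}) : Prop :=
  A :|: B = vertices H /\
  forall x y, x \in A :\: B -> y \in B :\: A -> [set x; y] \notin edges H.

(* The bounds |A \ B|, |B \ A| <= 2n/3, with the denominator cleared. *)
Definition balanced (T : finType) (H : sgraph T) (A B : {set T}) : Prop :=
  3 * #|A :\: B| <= 2 * #|vertices H| /\ 3 * #|B :\: A| <= 2 * #|vertices H|.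

Definition is_separation_number (T : finType) (G : sgraph T) (s : nat) : Prop :=
  is_least (fun s => forall H : sgraph T, subgraph H G ->
    exists A B : {set T},
      [/\ separation H A B, balanced H A B & #|A :&: B| <= s]) s.

(* Main.v *)
(* Let h = k/2 + 1 and let G be the disjoint union of a long ring (the circulant
   graph with steps 1 and h on 6h^2 vertices) and of K_(2,2k+1). Placing the
   ring vertices on the circle in cyclic order, an edge of step h separates
   h - 1 vertices from the rest, each with two incident edges of step h, whence
   k crossings; in K_(2,2k+1) an edge at one hub only crosses edges from the
   other hub to the at most k other leaves on the same side of the two hubs.
   Conversely, in every drawing of K_(2,2k+1) one side of the two hubs contains
   k + 1 leaves, and the last of them crosses k edges. A prefix of the vertex
   order has at most 2h = k + 2 vertices with a later neighbour, bounding the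
   separation number from above. The ring, cut into 6h columns of h consecutive
   vertices, attains the bound: when fewer than 2h vertices are deleted, one of
   the h cycles of step h loses at most one vertex, hence stays connected and
   joins the more than 4h columns left intact. *)
Require Import Defs.
From mathcomp Require Import all_boot all_order all_algebra.
From mathcomp Require Import boolp reals.
From mathcomp Require Import zify ring lra.

Set Implicit Arguments.
Unset Strict Implicit.
Unset Printing Implicit Defensive.

Import Order.TTheory GRing.Theory Num.Theory.

(** * Parametrising a circle from one of its points *)

Section Circle.
Local Open Scope ring_scope.
Variable R : realType.
Implicit Types (u n c w : R * R) (t r : R).

(** Second intersection of the circle through [u] centred at [u + n] with the line through [u] in
    direction [n + t * n'], where [n'] is [n] turned by a right angle. *)
Definition circle_point u n t : R * R :=
  (u.1 + 2 / (1 + t ^+ 2) * (n.1 - t * n.2),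
   u.2 + 2 / (1 + t ^+ 2) * (n.2 + t * n.1)).

Lemma onedsqr_gt0 t : 0 < 1 + t ^+ 2.
Proof. by rewrite ltr_pwDl ?ltr01 ?sqr_ge0. Qed.

Lemma onedsqr_neq0 t : 1 + t ^+ 2 != 0.
Proof. by rewrite gt_eqF ?onedsqr_gt0. Qed.

(** The parameter is the slope [X / Y] of the chord [uw] measured from the inward normal at [u]. It
    is finite because both points lie on the circle, so [2 * Y] is the squared distance of [u] and
    [w]. *)
Lemma circle_pointP c r u w : 0 < r ->
  (u.1 - c.1) ^+ 2 + (u.2 - c.2) ^+ 2 = r ^+ 2 ->
  (w.1 - c.1) ^+ 2 + (w.2 - c.2) ^+ 2 = r ^+ 2 ->
  w <> u -> exists t, w = circle_point u (c.1 - u.1, c.2 - u.2) t.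
Proof.
case: c u w => [c1 c2] [u1 u2] [w1 w2] /= r0 hu hw neq.
set Y := (w1 - u1) * (c1 - u1) + (w2 - u2) * (c2 - u2).
set X := (w2 - u2) * (c1 - u1) - (w1 - u1) * (c2 - u2).
have hY : 2 * Y = (w1 - u1) ^+ 2 + (w2 - u2) ^+ 2.
  apply/eqP; rewrite -subr_eq0; apply/eqP.
  by rewrite -(subrr (r ^+ 2)) -{1}hu -hw /Y; ring.
have Y0 : 0 < Y.
  suff : 0 < 2 * Y by rewrite pmulr_rgt0.
  rewrite hY lt_neqAle addr_ge0 ?sqr_ge0 // andbT eq_sym paddr_eq0 ?sqr_ge0 //.
  rewrite !sqrf_eq0 !subr_eq0; apply/negP => /andP[/eqP e1 /eqP e2].
  by apply: neq; rewrite e1 e2.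
have r2 : r ^+ 2 != 0 by rewrite sqrf_eq0 gt_eqF.
have hXY : X ^+ 2 + Y ^+ 2 = 2 * Y * r ^+ 2.
  by rewrite hY -hu /X /Y; ring.
have Yn : Y != 0 by rewrite gt_eqF.
exists (X / Y).
have -> : circle_point (u1, u2) (c1 - u1, c2 - u2) (X / Y) =
   (u1 + (Y * (c1 - u1) - X * (c2 - u2)) / r ^+ 2,
    u2 + (Y * (c2 - u2) + X * (c1 - u1)) / r ^+ 2).
  have e : 2 / (1 + (X / Y) ^+ 2) = Y / r ^+ 2.
    have -> : 1 + (X / Y) ^+ 2 = 2 * r ^+ 2 / Y.
      have -> : 1 + (X / Y) ^+ 2 = (X ^+ 2 + Y ^+ 2) / Y ^+ 2 by field.
      by rewrite hXY; field.
    by field; rewrite (gt_eqF r0).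
  by rewrite /circle_point e /=; congr (_, _); field; rewrite (gt_eqF r0).
congr (_, _).
  have -> : Y * (c1 - u1) - X * (c2 - u2) = (w1 - u1) * r ^+ 2.
    by rewrite -hu /X /Y; ring.
  by rewrite mulfK //; ring.
have -> : Y * (c2 - u2) + X * (c1 - u1) = (w2 - u2) * r ^+ 2.
  by rewrite -hu /X /Y; ring.
by rewrite mulfK //; ring.
Qed.

(* Seen from [u], the points of the circle are ordered by [t], so a chord from
   [u] separates the parameters smaller and larger than that of its endpoint. *)
Lemma circle_chords_meet u n t1 t2 t3 : t1 < t2 < t3 ->
  let P := circle_point u n in
  exists s s', [/\ 0 < s < 1, 0 < s' < 1,
    (1 - s) * u.1 + s * (P t2).1 = (1 - s') * (P t1).1 + s' * (P t3).1 &
    (1 - s) * u.2 + s * (P t2).2 = (1 - s') * (P t1).2 + s' * (P t3).2].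
Proof.
move=> /andP[l12 l23] P.
set a := t3 - t2; set b := t2 - t1.
have a0 : 0 < a by rewrite subr_gt0.
have b0 : 0 < b by rewrite subr_gt0.
have ab0 : 0 < a + b by apply: addr_gt0.
set W := a * (1 + t1 ^+ 2) + b * (1 + t3 ^+ 2).
have p1 : 0 < a * (1 + t1 ^+ 2) by rewrite mulr_gt0 ?onedsqr_gt0.
have p3 : 0 < b * (1 + t3 ^+ 2) by rewrite mulr_gt0 ?onedsqr_gt0.
have W0 : 0 < W by apply: addr_gt0.
have Wn : W != 0 by rewrite gt_eqF.
(* Strict convexity of [1 + t ^+ 2]; this is what places the meeting point before the circle on the
   ray to [P t2]. *)
have conv : W - (a + b) * (1 + t2 ^+ 2) = a * b * (a + b).
  by rewrite /W /a /b; ring.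
have n1 := onedsqr_neq0 t1; have n2 := onedsqr_neq0 t2.
have n3 := onedsqr_neq0 t3.
(* The direction for [t2] is the mean of those for [t1] and [t3] with weights [a] and [b]. Undoing
   the factors [2 / (1 + t ^+ 2)] and normalising by [W] gives both ratios. *)
exists ((a + b) * (1 + t2 ^+ 2) / W), (b * (1 + t3 ^+ 2) / W); split.
- rewrite divr_gt0 ?(mulr_gt0 ab0) ?onedsqr_gt0 //=.
  by rewrite ltr_pdivrMr // mul1r -subr_gt0 conv; do 2!apply: mulr_gt0 => //.
- by rewrite divr_gt0 //= ltr_pdivrMr // mul1r /W ltrDr.
- rewrite /P /circle_point /= /W /a /b; field.
  by rewrite n1 n2 n3 -/a -/b -/W Wn.
- rewrite /P /circle_point /= /W /a /b; field.
  by rewrite n1 n2 n3 -/a -/b -/W Wn.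
Qed.

End Circle.

(** * Crossings in the standard drawing *)

Lemma set2_eqP (T : finType) (x y a b : T) : [set x; y] = [set a; b] ->
  (x = a /\ y = b) \/ (x = b /\ y = a).
Proof.
move=> e.
have /set2P ha : a \in [set x; y] by rewrite e set21.
have /set2P hb : b \in [set x; y] by rewrite e set22.
have /set2P hx : x \in [set a; b] by rewrite -e set21.
have /set2P hy : y \in [set a; b] by rewrite -e set22.
by case: ha; case: hb; case: hx; case: hy => *; subst; auto.
Qed.

Definition interleaved (a b c d : nat) : bool :=
  let inside x := minn a b < x < maxn a b in
  let outside x := (x < minn a b) || (maxn a b < x) in
  inside c && outside d || outside c && inside d.

Lemma interleavedCl (a b c d : nat) : interleaved b a c d = interleaved a b c d.
Proof. by rewrite /interleaved minnC maxnC. Qed.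

Lemma interleavedCr (a b c d : nat) : interleaved a b d c = interleaved a b c d.
Proof. by rewrite /interleaved orbC andbC [X in _ || X]andbC. Qed.

Section StandardDrawing.
Local Open Scope ring_scope.
Variable R : realType.

Lemma open_segment_pair (T : finType) (p : T -> R * R) (a b : T) (q : R * R) :
  in_open_segment p [set a; b] q ->
  exists t, 0 < t < 1 /\
    q = ((1 - t) * (p a).1 + t * (p b).1, (1 - t) * (p a).2 + t * (p b).2).
Proof.
move=> [x [y [t [e t01 ->]]]].
case: (set2_eqP e) => -[-> ->]; first by exists t.
exists (1 - t); split; first by move: t01 => /andP[? ?]; apply/andP; split; lra.
by congr (_, _); ring.
Qed.

(** Rational points of the unit circle seen from [(-1, 0)], so the order of the labels is the cyclic
    order of the points. *)
Definition std_drawing (N : nat) (i : 'I_N) : R * R :=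
  circle_point (-1, 0) (1, 0) (i : nat)%:R.

Lemma std_drawing_convex (N : nat) (G : sgraph 'I_N) :
  convex_drawing G (@std_drawing N).
Proof.
split=> [x y _ _|].
  rewrite /std_drawing /circle_point /= !mulr0 !subr0 !mulr1 !add0r => -[].
  move=> /addrI e; rewrite e => e2.
  have n0 : 2 / (1 + y%:R ^+ 2) != 0 :> R.
    by rewrite mulf_neq0 ?pnatr_eq0 // invr_eq0 onedsqr_neq0.
  by move: (mulfI n0 e2) => /eqP; rewrite eqr_nat => /eqP /val_inj.
exists (0, 0), 1; split=> [//|v _] /=.
by field; exact: onedsqr_neq0.
Qed.

(* An affine function vanishing at both endpoints of the chord [ab] and having
   the sign of [(t - a) * (t - b)] at the point of parameter [t]. *)
Definition chord_form (a b : nat) (q : R * R) : R :=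
  (1 - q.1) - (a%:R + b%:R) * q.2 + a%:R * b%:R * (1 + q.1).

Lemma chord_form_drawing (N a b : nat) (i : 'I_N) :
  chord_form a b (std_drawing i) =
    2 / (1 + (i : nat)%:R ^+ 2) * ((i%:R - a%:R) * (i%:R - b%:R)).
Proof.
rewrite /chord_form /std_drawing /circle_point /=.
by field; exact: onedsqr_neq0.
Qed.

(** [chord_form a b] vanishes at the crossing point, a proper convex combination of [c] and [d].
    Hence its values at [c] and [d] have opposite signs or are both zero. *)
Lemma crosses_interleaved (N : nat) (a b c d : 'I_N) : c != d ->
  crosses (@std_drawing N) [set a; b] [set c; d] -> interleaved a b c d.
Proof.
move=> cd [ne [q [/open_segment_pair[s [_ qs]] /open_segment_pair[t [t01
  qt]]]]].
have z : chord_form a b q = 0.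
  have -> : chord_form a b q = (1 - s) * chord_form a b (std_drawing a) +
            s * chord_form a b (std_drawing b).
    by rewrite qs /chord_form /=; ring.
  by rewrite !chord_form_drawing; ring.
have : chord_form a b q = (1 - t) * chord_form a b (std_drawing c) +
         t * chord_form a b (std_drawing d).
  by rewrite qt /chord_form /=; ring.
rewrite z !chord_form_drawing => {z qs qt q s}.
set A := (c%:R - a%:R) * _; set B := (d%:R - a%:R) * _.
have [t0 t1] := andP t01.
have Kc : 0 < (1 - t) * (2 / (1 + (c : nat)%:R ^+ 2)).
  by rewrite !mulr_gt0 ?invr_gt0 ?onedsqr_gt0 ?subr_gt0.
have Kd : 0 < t * (2 / (1 + (d : nat)%:R ^+ 2)).
  by rewrite !mulr_gt0 ?invr_gt0 ?onedsqr_gt0.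
rewrite !mulrA; move: Kc Kd; rewrite !mulrA.
set u := _ / (1 + c%:R ^+ 2); set v := _ / (1 + d%:R ^+ 2) => Kc Kd e.
have {}e : 0 = u * A + v * B by rewrite e /u /v /A /B; ring.
have sgnP (x : 'I_N) : ((x%:R - a%:R) * (x%:R - b%:R) < 0 :> R) =
    (minn a b < x < maxn a b)%N.
  rewrite mulr_lt0 !subr_eq0 !subr_lt0 !eqr_nat !ltr_nat; lia.
have sgnN (x : 'I_N) : (0 < (x%:R - a%:R) * (x%:R - b%:R) :> R) =
    ((x < minn a b) || (maxn a b < x))%N.
  rewrite -oppr_lt0 -mulNr opprB mulr_lt0 !subr_eq0 !subr_lt0 !eqr_nat.
  rewrite !ltr_nat; lia.
rewrite /interleaved -!sgnP -!sgnN -/A -/B.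
case: (ltrgtP A 0) => hA; case: (ltrgtP B 0) => hB //=; exfalso.
- have : u * A < 0 by rewrite pmulr_rlt0.
  have : v * B < 0 by rewrite pmulr_rlt0.
  by move=> h1 h2; move: (ltrD h1 h2); rewrite addrC -e addr0 ltxx.
- have : u * A < 0 by rewrite pmulr_rlt0.
  by rewrite hB mulr0 addr0 in e; rewrite -e ltxx.
- have : 0 < u * A by rewrite pmulr_rgt0.
  have : 0 < v * B by rewrite pmulr_rgt0.
  by move=> h1 h2; move: (addr_gt0 h1 h2); rewrite addrC -e ltxx.
- have : 0 < u * A by rewrite pmulr_rgt0.
  by rewrite hB mulr0 addr0 in e; rewrite -e ltxx.
- have : v * B < 0 by rewrite pmulr_rlt0.
  by rewrite hA mulr0 add0r in e; rewrite -e ltxx.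
- have : 0 < v * B by rewrite pmulr_rgt0.
  by rewrite hA mulr0 add0r in e; rewrite -e ltxx.
(* Both values zero put [c] and [d] in [{a, b}]; being distinct, they form the same edge, which does
   not cross itself. *)
- move/eqP: hA; move/eqP: hB; rewrite !mulf_eq0 !subr_eq0 !eqr_nat.
  move=> /orP[] /eqP /val_inj hd /orP[] /eqP /val_inj hc; subst.
  all: try by rewrite eqxx in cd.
  + by apply: ne; rewrite setUC.
  + by apply: ne.
Qed.

End StandardDrawing.

(** * Separations obtained from a linear vertex order *)

Lemma card_ord_interval (N a b : nat) : #|[set x : 'I_N | a <= x < b]| <= b - a.
Proof.
rewrite cardE -(size_map val) -[leqRHS](size_iota a).
apply: uniq_leq_size; first by rewrite (map_inj_uniq val_inj) enum_uniq.
move=> z /mapP[x]; rewrite mem_enum inE => xab ->; rewrite mem_iota.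
by move: xab => /=; lia.
Qed.

(** Cut the order at the shortest prefix holding at least a third of [H]: minimality bounds the
    prefix, the third bounds the rest, and the separator consists of prefix vertices with a later
    neighbour. *)
Lemma layout_separation (N s : nat) (G H : sgraph 'I_N) : 2 <= s ->
  (forall i, #|[set x : 'I_N | (x < i) &&
     [exists y : 'I_N, (i <= y) && ([set x; y] \in edges G)]]| <= s) ->
  subgraph H G ->
  exists A B : {set 'I_N},
    [/\ separation H A B, balanced H A B & #|A :&: B| <= s].
Proof.
move=> s2 hs [_ sub]; set V := vertices H; set n := #|V|.
(* At most [s] vertices can all go into the separator; otherwise [n >= 3], so one vertex beyond a
   third stays within two thirds. *)
case: (leqP n s) => ns.
  exists V, V; split; last by rewrite setIid.
    by split=> [|x y]; rewrite ?setUid // setDv inE.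
  by split; rewrite setDv cards0.
pose c i := #|[set x in V | (x : 'I_N) < i]|.
have exi : exists i, n <= 3 * c i.
  exists N; have -> : c N = n.
    by rewrite /c /n; congr #|pred_of_set _|; apply/setP=> x;
      rewrite inE ltn_ord andbT.
  by lia.
case: (ex_minnP exi) => -[|i] hi mini.
  have c0 : c 0 = 0 by apply/eqP; rewrite cards_eq0; apply/eqP/setP=> x;
    rewrite !inE andbF.
  by move: hi; rewrite c0; lia.
have ci : 3 * c i < n by rewrite ltnNge; apply/negP=> /mini; rewrite ltnn.
have ciS : c i.+1 <= c i + 1.
  have sc : [set x in V | (x : 'I_N) < i.+1] \subset
     [set x in V | (x : 'I_N) < i] :|: [set x | i <= (x : 'I_N) < i.+1].
    by apply/subsetP=> x; rewrite !inE => /andP[-> /=]; lia.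
  apply: leq_trans (subset_leq_card sc) _;
    apply: leq_trans (leq_card_setU _ _) _.
  by rewrite leq_add2l; apply: leq_trans (card_ord_interval _ _ _) _; lia.
pose A := [set x in V | (x : 'I_N) < i.+1].
pose S := [set x : 'I_N | (x < i.+1) &&
     [exists y : 'I_N, (i.+1 <= y) && ([set x; y] \in edges G)]].
pose B := [set x in V | (x \in S) || (i.+1 <= x)].
have cA : c i.+1 = #|A| by [].
exists A, B; split.
- split.
    by apply/setP=> x; rewrite !inE; case: (x \in V) => //=; case: ltnP;
      rewrite ?orbT.
  move=> x y; rewrite !inE => /andP[+ /andP[xV xi]] /andP[+ /andP[yV _]].
  rewrite xV xi yV /= => /norP[/existsPn nS _]; rewrite -leqNgt => yi.
  by apply/negP=> /(subsetP sub) e; have := nS y; rewrite yi e.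
- split.
    have : #|A :\: B| <= #|A| by rewrite subset_leq_card ?subsetDl.
    by rewrite -cA -/n; lia.
  have sD : B :\: A \subset V :\: A.
    apply/subsetP=> x /setDP[xB xA]; rewrite inE xA /=.
    by move: xB; rewrite inE => /andP[].
  have AV : A \subset V by apply/subsetP=> x; rewrite inE => /andP[].
  move: (subset_leq_card sD); rewrite (cardsDS AV) -cA -/n; lia.
- apply: leq_trans (hs i.+1); apply: subset_leq_card.
  apply/subsetP=> x; rewrite !inE => /andP[/andP[_ xi] /andP[_]].
  by rewrite xi /= ltnNge -ltnS xi orbF.
Qed.

(** * Graphs induced by a relation on a vertex set *)

Section GraphOf.
Variables (T : finType) (V : {set T}) (r : rel T).
Hypothesis r_irr : irreflexive r.

Definition graph_edges : {set {set T}} :=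
  [set [set xy.1; xy.2] | xy in [set xy : T * T |
     [&& xy.1 \in V, xy.2 \in V & r xy.1 xy.2]]].

Lemma graph_edgesP (e : {set T}) :
  reflect (exists x y, [/\ x \in V, y \in V, r x y & e = [set x; y]])
          (e \in graph_edges).
Proof.
apply: (iffP imsetP) => [[[x y]]|[x [y [xV yV rxy ->]]]].
  by rewrite inE => /and3P[xV yV rxy] ->; exists x, y.
by exists (x, y) => //; rewrite inE xV yV.
Qed.

Fact graph_edges_pairs (e : {set T}) :
  e \in graph_edges -> e \subset V /\ #|e| = 2.
Proof.
move=> /graph_edgesP[x [y [xV yV rxy ->]]]; rewrite cards2; split.
  by rewrite subUset !sub1set xV.
by case: eqP rxy => // <-; rewrite r_irr.
Qed.

Definition graph_of : sgraph T := SGraph graph_edges_pairs.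

End GraphOf.

(** Pigeonhole on the two sides of [s], then the element nearest to [s] on the larger side. It
    serves to find an edge that many others must cross. *)
Lemma nearest_on_large_side (R : realType) (T : finType) (W : {set T})
    (t : T -> R) (s : R) (l : nat) :
  {in W, forall x, t x != s} -> {in W &, injective t} -> l.*2 < #|W| ->
  exists (X : {set T}) (w : T), [/\ X \subset W, l < #|X|, w \in X &
    forall x, x \in X -> x != w ->
      ((s < t w < t x) || (t x < t w < s))%R].
Proof.
move=> ts tI cW.
set P := [set x in W | (s < t x)%R]; set Q := [set x in W | (t x < s)%R].
have sP : P \subset W by apply/subsetP=> x; rewrite inE => /andP[].
have sQ : Q \subset W by apply/subsetP=> x; rewrite inE => /andP[].
have : #|W| <= #|P| + #|Q|.
  apply: leq_trans (leq_card_setU _ _); apply: subset_leq_card.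
  apply/subsetP=> x xW; rewrite !inE xW /=.
  by case: ltrgtP (ts _ xW).
case: (ltnP l #|P|) => cP cPQ.
  have /card_gt0P[w0 w0P] : 0 < #|P| by lia.
  case: (arg_minP t w0P) => w wP wmin.
  exists P, w; split=> // x xP xw; apply/orP; left.
  have : w \in P := wP; rewrite inE => /andP[wW ->] /=.
  rewrite lt_neqAle (wmin _ xP) andbT; apply: contraNneq xw => e.
  by rewrite (tI x w) ?(subsetP sP).
have cQ : l < #|Q| by lia.
have /card_gt0P[w0 w0Q] : 0 < #|Q| by lia.
case: (arg_maxP t w0Q) => w wQ wmax.
exists Q, w; split=> // x xQ xw; apply/orP; right.
have : w \in Q := wQ; rewrite inE => /andP[wW ->] /=.
have le : (t x <= t w)%R := wmax _ xQ.
rewrite lt_neqAle le !andbT; apply: contraNneq xw => e.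
by rewrite (tI x w) ?(subsetP sQ).
Qed.

(** * The example graph and its vertex order *)

Section Example.
Variables g M : nat.
Hypothesis M_large : 6 * g.+1 <= M.
Local Notation h := g.+1.
Local Notation k := g.*2.
Local Notation N := (M + k.*2 + 2).+1.

(* The vertices below [M] form the circulant graph on Z/M with steps 1
   (wrapping edge omitted) and [h]; the others form K_(2,2k+1), whose side of
   size two consists of the hubs [M] and [M + k + 1]. *)
Definition hub (z : nat) : bool := (z == M) || (z == M + k.+1).

Definition link (x y : nat) : bool :=
  (x < y) &&
  ((y < M) && [|| y - x == 1, y - x == h | y - x == M - h] ||
   (M <= x) && (hub x (+) hub y)).

Definition link_rel : rel 'I_N := fun x y => link x y.

Lemma link_irr : irreflexive link_rel.
Proof. by move=> x; rewrite /link_rel /link ltnn. Qed.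

Definition example_graph (V : {set 'I_N}) : sgraph 'I_N := graph_of V link_irr.

Lemma link_edge (V : {set 'I_N}) (x y : 'I_N) : x \in V -> y \in V ->
  link x y || link y x -> [set x; y] \in edges (example_graph V).
Proof.
move=> xV yV /orP[] a; apply/graph_edgesP; first by exists x, y.
by exists y, x; rewrite setUC.
Qed.

Lemma edge_link (V : {set 'I_N}) (x y : 'I_N) :
  [set x; y] \in edges (example_graph V) -> link x y || link y x.
Proof.
by move=> /graph_edgesP[a [b [_ _ ab /set2_eqP[] [-> ->]]]];
  rewrite /link_rel in ab;
  rewrite ab ?orbT.
Qed.

(** A cut inside the ring is crossed only from the first [h] vertices (wrapping edges) and the last
    [h] before it. Between the hubs the prefix has at most [k + 1] vertices outside the ring; after
    the second hub only the hubs have later neighbours. *)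
Lemma example_layout (i : nat) :
  #|[set x : 'I_N | (x < i) && [exists y : 'I_N, (i <= y) &&
     ([set x; y] \in edges (example_graph setT))]]| <= k + 2.
Proof.
set S := [set x | _].
have SP (x : 'I_N) : x \in S -> exists y : 'I_N, x < i <= y /\ link x y.
  rewrite inE => /andP[xi /existsP[y /andP[iy /edge_link]]].
  case/orP=> a; exists y; rewrite xi iy; first by [].
  by move: a; rewrite /link; lia.
have Ile a b := card_ord_interval N a b.
case: (leqP i M) => iM.
  have sub : S \subset [set x | 0 <= (x : 'I_N) < h] :|: [set x | i - h <= (x :
    'I_N) < i].
    apply/subsetP=> x /SP[y [xiy a]]; rewrite !inE.
    by move: xiy a; rewrite /link /hub; lia.
  apply: leq_trans (subset_leq_card sub) _.
  apply: leq_trans (leq_card_setU _ _) _.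
  by apply: leq_trans (leq_add (Ile _ _) (Ile _ _)) _; lia.
case: (leqP i (M + k.+1)) => iv.
  have sub : S \subset [set x | M <= (x : 'I_N) < i].
    apply/subsetP=> x /SP[y [xiy a]]; rewrite !inE.
    by move: xiy a; rewrite /link /hub; lia.
  apply: leq_trans (subset_leq_card sub) _.
  by apply: leq_trans (Ile _ _) _; lia.
have sub : S \subset [set x | M <= (x : 'I_N) < M.+1] :|:
    [set x | M + k.+1 <= (x : 'I_N) < (M + k.+1).+1].
  apply/subsetP=> x /SP[y [xiy a]]; rewrite !inE.
  by move: xiy a; rewrite /link /hub; lia.
apply: leq_trans (subset_leq_card sub) _.
apply: leq_trans (leq_card_setU _ _) _.
by apply: leq_trans (leq_add (Ile _ _) (Ile _ _)) _; lia.
Qed.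

(** Edges at the same hub share an endpoint, and edges at different hubs are disjoint when their
    leaves lie on different sides of the two hubs. *)
Lemma biclique_interleaved (u w o z : nat) :
  hub u -> ~~ hub w -> hub o -> ~~ hub z -> M <= w -> M <= z ->
  interleaved u w o z ->
  [/\ o = (if u == M then M + k.+1 else M), z <> w &
      if w < M + k.+1 then M < z < M + k.+1 else M + k.+1 < z].
Proof.
rewrite /interleaved /hub => /orP[] /eqP -> /norP[/eqP w1 /eqP w2].
  rewrite eqxx => oh /norP[/eqP z1 /eqP z2] wM zM.
  have [-> ->] : minn M w = M /\ maxn M w = w by lia.
  move=> il; have oM : o = M + k.+1 by case/orP: oh => /eqP e; move: il; lia.
  move: il; rewrite oM; case: ifP => wv il; split=> //; lia.
have -> : (M + k.+1 == M) = false by lia.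
move=> oh /norP[/eqP z1 /eqP z2] wM zM; case: (ltnP w (M + k.+1)) => wv.
  move=> il; have oM : o = M by case/orP: oh => /eqP e; move: il; lia.
  by move: il; rewrite oM => il; split=> //; lia.
move=> il; have oM : o = M by case/orP: oh => /eqP e; move: il; lia.
by move: il; rewrite oM => il; split=> //; lia.
Qed.

(** * Crossings per edge: upper and lower bounds *)

Section Crossings.
Variable R : realType.

Lemma example_drawing (e : {set 'I_N}) :
  e \in edges (example_graph setT) ->
  #|[set f in edges (example_graph setT) |
      `[< crosses (@std_drawing R N) e f >]]| <= k.
Proof.
move=> /graph_edgesP[a [b [_ _ ab ->]]]; rewrite /link_rel in ab.
set C := [set f in _ | _].
have CP f : f \in C -> exists c d : 'I_N,
    [/\ f = [set c; d], link c d & interleaved a b c d].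
  rewrite inE => /andP[/graph_edgesP[c [d [_ _ cd ->]]] /asboolP cr].
  exists c, d; split=> //; apply: crosses_interleaved cr.
  by apply/eqP=> cd0; rewrite cd0 link_irr in cd.
have aN := ltn_ord a; have bN := ltn_ord b.
have [bM|bM] := ltnP b M.
  (* No vertex lies strictly between consecutive ones, so a step-1 edge is uncrossed. *)
  have [ab1|ab1] := eqVneq (b - a) 1.
    rewrite (eq_card0 (A := C)) // => f.
    apply/negbTE/negP=> /CP[c [d [_ _]]].
    by move: ab1 ab; rewrite /interleaved /link; lia.
  (* The [h - 1 = g] ring vertices on the short side of the chord; for a wrapping edge these lie
     before [a] and after [b]. *)
  pose I : {set 'I_N} := if b - a == h then [set x | a.+1 <= (x : 'I_N) < b]
    else [set x | 0 <= (x : 'I_N) < a] :|: [set x | b.+1 <= (x : 'I_N) < M].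
  have cI : #|I| <= g.
    rewrite /I; have Ile := card_ord_interval N; case: eqP => abh.
      by apply: leq_trans (Ile _ _) _; lia.
    apply: leq_trans (leq_card_setU _ _) _.
    apply: leq_trans (leq_add (Ile _ _) (Ile _ _)) _.
    by move: ab; rewrite /link; lia.
  (* The two step-[h] neighbours on the cycle. A crossing edge has an endpoint in [I] and is not of
     step 1, so it joins that endpoint to one of them. *)
  pose up (z : nat) := if z + h < M then z + h else z - (M - h).
  pose down (z : nat) := if h <= z then z - h else z + (M - h).
  have sub : C \subset [set [set z; inord (up z)] | z : 'I_N in I] :|:
                       [set [set z; inord (down z)] | z : 'I_N in I].
    apply/subsetP=> f /CP[c [d [-> cd il]]].
    have cIdI : (c \in I) || (d \in I).
      by move: cd il ab; rewrite /I; case: ifP;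
        rewrite !inE /interleaved /link; lia.
    have : (d = up c :> nat) /\ (c = down d :> nat) \/
           (c = up d :> nat) /\ (d = down c :> nat).
      have [dM cd'] : d < M /\ (d = c + h :> nat \/ d = c + (M - h) :> nat).
        by move: cd il ab bM ab1; clear -M_large; rewrite /interleaved /link;
          lia.
      by move: dM cd'; clear -M_large; rewrite /up /down; do 4!case: ifP; lia.
    rewrite inE; case/orP: cIdI => xI [] [e1 e2]; apply/orP.
    - by left; apply/imsetP; exists c => //; rewrite -e1 inord_val.
    - by right; apply/imsetP; exists c => //; rewrite -e2 inord_val.
    - by right; apply/imsetP; exists d => //; rewrite -e2 inord_val setUC.
    - by left; apply/imsetP; exists d => //; rewrite -e1 inord_val setUC.
  apply: leq_trans (subset_leq_card sub) _.
  apply: leq_trans (leq_card_setU _ _) _.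
  apply: (@leq_trans (g + g)); last by rewrite addnn.
  by apply: leq_add; apply: leq_trans (leq_imset_card _ _) cI.
have abh : (M <= a) && (hub a (+) hub b) by move: ab; rewrite /link; lia.
pose u := if hub a then a else b; pose w := if hub a then b else a.
have [uw [hu hw]] : (u = a /\ w = b \/ u = b /\ w = a) /\ hub u /\ ~~ hub w.
  by move: abh; rewrite /u /w; case: ifP => ha /andP[_] hb; split; auto; lia.
clearbody u w.
pose o : nat := if u == M :> nat then M + k.+1 else M.
(* The leaves on the side of [w]: there are [k] between the hubs and [k + 1] after them, so only in
   the second case must [w] be removed to reach [k]. *)
pose I := if w < M + k.+1 then [set x | M.+1 <= (x : 'I_N) < M + k.+1]
   else [set x | M + k.+2 <= (x : 'I_N) < N] :\ w.
have cI : #|I| <= k.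
  rewrite /I; have Ile := card_ord_interval N; case: ltnP => wv.
    by apply: leq_trans (Ile _ _) _; lia.
  have := Ile (M + k.+2) N; rewrite (cardsD1 w) inE.
  have -> : (M + k.+2 <= w < N).
    by by have := ltn_ord w; move: hw wv; rewrite /hub; lia.
  by rewrite add1n => lt_card; rewrite -ltnS; apply: leq_trans lt_card _; lia.
have sub : C \subset [set [set z; inord o] | z : 'I_N in I].
  apply/subsetP=> f /CP[c [d [-> cd il]]].
  have : (c \in I) && (d == o :> nat) || (d \in I) && (c == o :> nat).
    have cdM : (M <= c) && (M <= d) && (hub c (+) hub d).
      by move: abh cd il; rewrite /interleaved /link; lia.
    have wM : M <= w by case: uw => -[_ ->]; move: abh ab; clear;
      rewrite /link; lia.
    have {}il : interleaved u w c d.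
      by case: uw => -[-> ->] //; rewrite interleavedCl.
    move: cdM => /andP[/andP[cM dM]]; case: (boolP (hub c)) => hc hd /=.
      have [oc zw zI] := biclique_interleaved hu hw hc hd wM dM il.
      apply/orP; right; rewrite /o oc eqxx andbT /I.
      by move: zI zw (ltn_ord d); clear; case: ifP => _;
        rewrite !inE -?val_eqE /=; lia.
    rewrite interleavedCr in il.
    have [oc zw zI] := biclique_interleaved hu hw hd hc wM cM il.
    apply/orP; left; rewrite /o oc eqxx andbT /I.
    by move: zI zw (ltn_ord c); clear; case: ifP => _;
      rewrite !inE -?val_eqE /=; lia.
  case/orP=> /andP[xI /eqP <-]; apply/imsetP.
    by exists c => //; rewrite inord_val.
  by exists d => //; rewrite inord_val setUC.
apply: leq_trans (subset_leq_card sub) _.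
by apply: leq_trans (leq_imset_card _ _) cI.
Qed.

End Crossings.

(* The parameters of [circle_point] cut the circle open at the hub [u]; the
   leaf [w] nearest to the other hub [v], on the side of [v] with more than [k]
   leaves, gives an edge [uw] that separates [v] from [k] other leaves. *)
Lemma example_crossings_ge (R : realType) (m : nat) :
  outer_planar R (example_graph setT) m -> k <= m.
Proof.
move=> [p [[pI [c [r [r0 onc]]]] hm]].
pose u : 'I_N := inord M; pose v : 'I_N := inord (M + k.+1).
have uE : u = M :> nat by rewrite inordK //; lia.
have vE : v = M + k.+1 :> nat by rewrite inordK //; lia.
have vu : v != u by rewrite -val_eqE /= uE vE; lia.
have inV x : x \in vertices (example_graph setT) by exact: in_setT.
(* The hub [u] itself has no parameter and receives the default 0. *)
have tex (x : 'I_N) : exists s, x != u ->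
    p x = circle_point (p u) (c.1 - (p u).1, c.2 - (p u).2)%R s.
  have [->|xu] := eqVneq x u; first by exists 0%R.
  have [|s] := @circle_pointP _ c r (p u) (p x) r0 (onc u (inV u)) (onc x (inV
    x)).
    by move=> /(pI _ _ (inV x) (inV u)) e; rewrite e eqxx in xu.
  by exists s.
have [t tP] := boolp.choice tex.
have tI x y : x != u -> y != u -> t x = t y -> x = y.
  by move=> xu yu e; apply: pI; rewrite ?inV // (tP x xu) (tP y yu) e.
pose W := [set x : 'I_N | (M <= x) && ~~ hub x].
have WP x : x \in W -> [/\ x != u, x != v & M <= x].
  rewrite inE -!val_eqE /= uE vE /hub; by move=> xW; split; lia.
have cW : k.*2 < #|W|.
  have sC : ~: W \subset [set x | 0 <= (x : 'I_N) < M.+1] :|: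
      [set x | M + k.+1 <= (x : 'I_N) < (M + k.+1).+1].
    by apply/subsetP=> x; rewrite !inE /hub; lia.
  have := cardsC W; rewrite card_ord => cC.
  have := leq_trans (subset_leq_card sC) (leq_trans (leq_card_setU _ _)
    (leq_add (card_ord_interval _ _ _) (card_ord_interval _ _ _))).
  lia.
have tv : {in W, forall x, t x != t v}.
  by move=> x /WP[xu xv _]; apply: contraNneq xv => /tI ->.
have tIW : {in W &, injective t}.
  by move=> x y /WP[xu _ _] /WP[yu _ _]; exact: tI.
have [X [w [XW cX wX wP]]] := nearest_on_large_side tv tIW cW.
have [wu wv wM] := WP _ (subsetP XW _ wX).
have edge (x y : 'I_N) : hub x -> ~~ hub y -> M <= x -> M <= y ->
    [set x; y] \in edges (example_graph setT).
  move=> hx hy xM yM; apply: link_edge; rewrite ?inE //.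
  rewrite /link. rewrite hx (negbTE hy) xM yM /=.
  by case: ltngtP => // xy; rewrite ?orbT //; move: hy; rewrite -xy hx.
have hubu : hub u by rewrite /hub uE eqxx.
have hubv : hub v by rewrite /hub vE eqxx orbT.
have hubX x : x \in X -> ~~ hub x.
  by move=> /(subsetP XW); rewrite inE => /andP[].
have ue : [set u; w] \in edges (example_graph setT).
  by apply: edge => //; [exact: hubX | rewrite uE].
apply: leq_trans (hm _ ue).
have inj_leaf : {in X :\ w &, injective (fun x : 'I_N => [set v; x])}.
  move=> x y /setD1P[_ /(subsetP XW) /WP[_ xv _]] _.
  by move=> /set2_eqP[[_ ->]//|[_ e]]; rewrite e eqxx in xv.
(* Each leaf of [X] other than [w] contributes its edge to [v]; at least [k] such leaves remain. *)
move: cX; rewrite (cardsD1 w) wX add1n ltnS => /leq_trans; apply.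
rewrite -(card_in_imset inj_leaf); apply: subset_leq_card.
apply/subsetP=> _ /imsetP[x /setD1P[xw xX] ->].
have [xu xv xM] := WP _ (subsetP XW _ xX).
rewrite inE edge ?hubX //=; last by rewrite vE leq_addr.
apply/asboolP; split.
  by move=> /set2_eqP[[e _]|[e _]]; [rewrite e eqxx in vu|rewrite e eqxx in xu].
case/orP: (wP _ xX xw) => /circle_chords_meet;
  move=> /(_ (p u) (c.1 - (p u).1, c.2 - (p u).2)%R) [a [b []]];
  rewrite -(tP v vu) -(tP w wu) -(tP x xu) => a01 b01 e1 e2.
  eexists; split; first by exists u, w, a.
  by exists v, x, b; split=> //; rewrite e1 e2.
eexists; split; first by exists u, w, a.
by exists x, v, b; split=> //; [rewrite setUC|rewrite e1 e2].
Qed.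
End Example.

(** * Lower bound on separations of the ring *)

Lemma cycle_minus_point (n j0 : nat) (C : nat -> bool) :
  (forall j, j.+1 < n -> j != j0 -> j.+1 != j0 -> C j = C j.+1) ->
  (0 != j0 -> n.-1 != j0 -> C 0 = C n.-1) ->
  forall a b, a < n -> b < n -> a != j0 -> b != j0 -> C a = C b.
Proof.
move=> step wrap.
(* A cycle without [j0] is a path: values below [j0] propagate to [0], those above to [n.-1], and
   the wrapping edge joins these ends. A [j0] of at least [n] deletes nothing. *)
have low a : a < j0 -> a < n -> C a = C 0.
  by elim: a => // a IH aj an; rewrite -step ?IH //; lia.
have high d : j0 < n.-1 - d -> C (n.-1 - d) = C n.-1.
  elim: d => [|d IH] jd; first by rewrite subn0.
  rewrite -IH; last by lia.
  have -> : n.-1 - d = (n.-1 - d.+1).+1 by lia.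
  by apply: step; lia.
have {}high a : j0 < a -> a < n -> C a = C n.-1.
  move=> ja an; have -> : a = n.-1 - (n.-1 - a) by lia.
  by apply: high; lia.
move=> a b an bn aj bj.
have [a1|a1|e] := ltngtP a j0; last by rewrite e eqxx in aj.
  have [b1|b1|e] := ltngtP b j0; last by rewrite e eqxx in bj.
    by rewrite (low a) // (low b).
  by rewrite (low a) // (high b) // wrap //; lia.
have [b1|b1|e] := ltngtP b j0; last by rewrite e eqxx in bj.
  by rewrite (high a) // (low b) // wrap //; lia.
by rewrite (high a) // (high b).
Qed.

Lemma separation_same_side (T : finType) (H : sgraph T) (A B : {set T})
    (x y : T) : separation H A B -> [set x; y] \in edges H ->
  x \in vertices H -> y \in vertices H ->
  x \notin A :&: B -> y \notin A :&: B -> (x \in A) = (y \in A).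
Proof.
move=> [<- sep] exy; rewrite !inE => xAB yAB xS yS.
have s1 := sep x y; have s2 := sep y x;
  rewrite (setUC [set y]) exy !inE in s1 s2.
move: xAB yAB xS yS s1 s2; case: (x \in A); case: (y \in A) => //=;
  case: (x \in B); case: (y \in B) => //= _ _ _ _ s1 s2.
- by have := s1 isT isT.
- by have := s2 isT isT.
Qed.

Section RingSeparation.
Variable g : nat.
Local Notation h := g.+1.
Local Notation n := (6 * h).
Local Notation M := (n * h).
Local Notation N := (M + g.*2.*2 + 2).+1.

(** Column [j] is a block of [h] consecutive ring vertices; row [i] is a residue class modulo [h],
    which step [h] turns into a cycle because [h] divides [M]. *)
Let grid (j i : nat) : 'I_N := inord (j * h + i).

Let gridE j i : j < n -> i < h -> grid j i = j * h + i :> nat.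
Proof. by move=> jn ih; rewrite inordK //; nia. Qed.

Let ring_graph := @example_graph g M [set x : 'I_N | x < M].

Let grid_ring j i : j < n -> i < h -> grid j i \in vertices ring_graph.
Proof. by move=> jn ih; rewrite inE gridE //; nia. Qed.

Let grid_inj : injective (fun q : 'I_n * 'I_h => grid q.1 q.2).
Proof.
move=> [j i] [j' i'] /= /(congr1 (@nat_of_ord _)); rewrite !gridE // => e.
have ej : j = j' :> nat.
  by have := congr1 (divn^~ h) e; rewrite !divnMDl // !divn_small // !addn0.
by congr (_, _); apply: val_inj => //=; move: e; rewrite ej => /addnI.
Qed.

Let column_edge j i : j < n -> i.+1 < h ->
  [set grid j i; grid j i.+1] \in edges ring_graph.
Proof.
move=> jn ih; apply: link_edge; rewrite ?grid_ring //; try exact: ltnW.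
by apply/orP; left; rewrite /link !gridE //; [nia|exact: ltnW].
Qed.

Let row_edge j i : j.+1 < n -> i < h ->
  [set grid j i; grid j.+1 i] \in edges ring_graph.
Proof.
move=> jn ih; have jn' := ltnW jn; apply: link_edge; rewrite ?grid_ring //.
by apply/orP; left; rewrite /link !gridE //; nia.
Qed.

Let wrap_edge i : i < h -> [set grid 0 i; grid n.-1 i] \in edges ring_graph.
Proof.
move=> ih; apply: link_edge; rewrite ?grid_ring //; try lia.
have e : n.-1 * h = M - h by rewrite -subn1 mulnBl mul1n.
by apply/orP; left; rewrite /link !gridE ?e //; lia.
Qed.

Lemma ring_separation_order (A B : {set 'I_N}) :
  separation ring_graph A B -> balanced ring_graph A B -> h.*2 <= #|A :&: B|.
Proof.
move=> sep [balA balB]; rewrite leqNgt; apply/negP=> small.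
pose f (q : 'I_n * 'I_h) := grid q.1 q.2.
pose S := [set q | f q \in A :&: B].
have cS : #|S| < h.*2.
  rewrite -(card_imset _ grid_inj); apply: leq_ltn_trans small.
  by apply: subset_leq_card; apply/subsetP=> _ /imsetP[q + ->]; rewrite inE.
pose row i := [set j | (j, i) \in S].
have [i0 ci0] : exists i0, #|row i0| <= 1.
  case: (pselect (exists i0, #|row i0| <= 1)) => // no; exfalso.
  have : #|S| = \sum_i #|row i|.
    rewrite -sum1_card (partition_big snd xpredT) //=; apply: eq_bigr => i _.
    rewrite sum1_card -(card_imset (row i) (f := fun j => (j, i)));
      last by move=> a b [].
    apply: eq_card => -[j i']; rewrite unfold_in /=; apply/andP/imsetP.
      by move=> [jS /eqP <-]; exists j => //; rewrite inE.
    by move=> [j']; rewrite inE => jS [-> ->].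
  have : \sum_(i < h) 2 <= \sum_(i < h) #|row i|.
    apply: leq_sum => i _; rewrite ltnNge; apply/negP=> ri; apply: no.
    by exists i.
  by rewrite sum_nat_const card_ord muln2 => le e; move: cS;
    rewrite e ltnNge le.
(* The only deleted position of row [i0], or the out-of-range value [n] if the row is intact. *)
have [j0 rowj0] : exists j0 : nat, forall j : 'I_n, (j \in row i0) = (j == j0
  :> nat).
  have [r0|[j0 rj0]] := set_0Vmem (row i0).
    by exists n => j; rewrite r0 inE ltn_eqF.
  exists j0 => j; apply/idP/eqP => [jr|/val_inj ->//].
  congr nat_of_ord; apply/eqP; apply: contraLR ci0 => jj0; rewrite -ltnNge.
  have c2 : #|[set j; j0]| = 2 by rewrite cards2 jj0.
  by apply: leq_trans (eq_leq (esym c2)) _; apply: subset_leq_card;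
    rewrite subUset !sub1set jr.
have rowE a b : a < n -> b < n -> a != j0 -> b != j0 ->
    (grid a i0 \in A) = (grid b i0 \in A).
  have good j : j < n -> j != j0 -> grid j i0 \notin A :&: B.
    by move=> jn jj0; have := rowj0 (Ordinal jn);
      rewrite (negbTE jj0) !inE => ->.
  apply: (cycle_minus_point (C := fun j => grid j i0 \in A)).
    move=> j jn jj0 jj0'; have jn' := ltnW jn.
    by apply: (separation_same_side sep); rewrite ?row_edge ?grid_ring ?good.
  move=> z1 z2.
  by apply: (separation_same_side sep); rewrite ?wrap_edge ?grid_ring ?good.
pose D := [set q.1 | q in S].
have cD : #|D| < h.*2 by apply: leq_ltn_trans (leq_imset_card _ _) cS.
have clean (j : 'I_n) i : j \notin D -> i < h -> grid j i \notin A :&: B.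
  move=> jD ih; apply: contra jD => jS; apply/imsetP.
  by exists (j, Ordinal ih); rewrite // inE.
have colE (j : 'I_n) i : j \notin D -> i < h ->
    (grid j i \in A) = (grid j 0 \in A).
  move=> jD; elim: i => // i IH ih; rewrite -IH; last exact: ltnW.
  have ih' := ltnW ih.
  by symmetry; apply: (separation_same_side sep);
    rewrite ?column_edge ?grid_ring ?clean.
have cC : #|~: D| = n - #|D| by rewrite cardsCs setCK card_ord.
have [j1 j1D] : exists j1, j1 \in ~: D.
  by apply/card_gt0P; rewrite cC; lia.
pose K := [set f q | q in setX (~: D) [set: 'I_h]].
(* At most [2 * h - 1] of the [6 * h] columns are hit. *)
have cK : (4 * h + 1) * h <= #|K|.
  rewrite (card_imset _ grid_inj) cardsX cardsT card_ord cC.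
  by rewrite leq_mul2r; lia.
have clean_j0 (j : 'I_n) : j \notin D -> j != j0 :> nat.
  move=> jD; rewrite -rowj0; apply: contra jD; rewrite inE => jS.
  by apply/imsetP; exists (j, i0).
(* Any intact column is joined to column [j1] by moving within it to row [i0], along that row, and
   then within column [j1]. *)
have KE x : x \in K -> x \notin A :&: B /\ (x \in A) = (grid j1 0 \in A).
  move: j1D; rewrite inE => j1D /imsetP[[j i] + ->].
  rewrite in_setX in_setC in_setT andbT /f /= => jD.
  split; first by rewrite clean.
  rewrite colE // -(colE j i0) // (rowE j j1) ?clean_j0 //.
  by rewrite colE.
have KV : K \subset A :|: B.
  by rewrite sep.1; apply/subsetP=> _ /imsetP[[j i] _ ->]; exact: grid_ring.
have cV : #|vertices ring_graph| <= M.
  have -> : vertices ring_graph = [set x | 0 <= (x : 'I_N) < M] by [].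
  by apply: leq_trans (card_ord_interval _ _ _) _; rewrite subn0.
(* One side contains all of [K], more than [4 * h * h] vertices, which is two thirds of [M]. *)
have : #|K| <= #|if grid j1 0 \in A then A :\: B else B :\: A|.
  apply: subset_leq_card; apply/subsetP=> x xK; have [xS xA] := KE x xK.
  move: (subsetP KV x xK) xS xA; rewrite !inE.
  by case: ifP => j1A; rewrite inE => + + xA; rewrite xA //= andbT.
by case: ifP => _ KA; [move: balA|move: balB]; move: cK KA cV; clear; nia.
Qed.
End RingSeparation.

Theorem theorem17 (R : realType) (k : nat) (hk : ~~ odd k) :
  exists (T : finType) (G : sgraph T),
    is_convex_lcr R G k /\ is_separation_number G (k + 2).
Proof.
have [g ->] : exists g, k = g.*2 by exists k./2; rewrite even_halfK.
pose M := 6 * g.+1 * g.+1.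
have M_large : 6 * g.+1 <= M by rewrite leq_pmulr.
exists 'I_(M + g.*2.*2 + 2).+1, (@example_graph g M setT); split; split.
- exists (@std_drawing R _); split; first exact: std_drawing_convex.
  by move=> e; exact: example_drawing.
- by move=> m; exact: example_crossings_ge.
- move=> H; apply: layout_separation; first by rewrite addn2.
  by move=> i; exact: example_layout.
(* The subgraph forcing the order is the ring alone. *)
- move=> m /(_ (@example_graph g M [set x : 'I__ | x < M])) [|A [B [sep bal]]].
    split; first exact: subsetT.
    apply/subsetP=> e /graph_edgesP[x [y [_ _ xy ->]]].
    by apply/graph_edgesP; exists x, y; rewrite !inE.
  by apply: leq_trans; rewrite addn2; exact: ring_separation_order sep bal.
Qed.
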